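(* Let $\Sigma\subseteq\mathbb{R}^d$ be a closed convex set, let $g_0,h_0,g_1,h_1:\Sigma\to\mathbb{R}$ be convex functions, and consider $$(\mathrm{DC})\qquad \min_{z\in\Sigma}\ f_0(z):=g_0(z)-h_0(z)\quad\text{s.t.}\quad f_1(z):=g_1(z)-h_1(z)\le 0 .$$ Suppose $f_0$ is bounded below on $\Sigma$ and the sequences $\{z^k\}$ and $\{\beta_k\}$ generated by the algorithm iP-DCA (described in the context) are bounded. Moreover suppose the functions $g_0,g_1,h_1,h_0$ are locally Lipschitz on the set $\Sigma$. Then every accumulation point of $\{z^k\}$ is a KKT point of problem (DC).
   Context: $\partial$ is the subdifferential and $\mathcal N_\Sigma$ the normal cone of convex analysis; $\mathrm{dist}(x,M)$ is the distance from $x$ to the set $M$. ''Locally Lipschitz on $\Sigma$'' means Lipschitz around (on a neighbourhood of) each point of $\Sigma$, the functions being regarded as defined there. KKT point: a feasible point $\bar z$ of (DC) is a stationary/KKT point if there is $\lambda\ge 0$ such that $0\in\partial g_0(\bar z)-\partial h_0(\bar z)+\lambda(\partial g_1(\bar z)-\partial h_1(\bar z))+\mathcal N_\Sigma(\bar z)$ and $(g_1(\bar z)-h_1(\bar z))\lambda=0$. Algorithm iP-DCA: fix $\rho>0$, $\delta_\beta>0$, $\beta_0>0$ and $z^0\in\Sigma$. For $k=0,1,\dots$: 1. Choose $\xi_i^k\in\partial h_i(z^k)$, $i=0,1$. 2. Let $\tilde\varphi_k(z):=g_0(z)-h_0(z^k)-\langle\xi_0^k,z-z^k\rangle+\beta_k\max\{g_1(z)-h_1(z^k)-\langle\xi_1^k,z-z^k\rangle,0\}+\frac{\rho}{2}\|z-z^k\|^2$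 and choose $z^{k+1}\in\Sigma$ as an approximate minimizer of $\tilde\varphi_k$ over $\Sigma$ satisfying one of the two criteria: (I) $\mathrm{dist}(0,\partial\tilde\varphi_k(z^{k+1})+\mathcal N_\Sigma(z^{k+1}))\le\zeta_k$, where $\zeta_k\ge0$ and $\sum_{k=0}^\infty\zeta_k^2<\infty$; (II) $\mathrm{dist}(0,\partial\tilde\varphi_k(z^{k+1})+\mathcal N_\Sigma(z^{k+1}))\le\frac{\sqrt2}{2}\rho\|z^k-z^{k-1}\|$ (meaningful for $k\ge1$). 3. Set $t^{k+1}:=\max\{g_1(z^{k+1})-h_1(z^k)-\langle\xi_1^k,z^{k+1}-z^k\rangle,0\}$. 4. Set $\beta_{k+1}=\beta_k+\delta_\beta$ if $\max\{\beta_k,1/t^{k+1}\}<\|z^{k+1}-z^k\|^{-1}$ and $\beta_{k+1}=\beta_k$ otherwise (with $1/0=+\infty$). (In practice the procedure is stopped when $\max\{\|z^{k+1}-z^k\|,t^{k+1}\}$ is below a tolerance; for the convergence statement this test is disregarded and the infinite sequence is considered.) *)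

(* Defs.v *)
From HB Require Import structures.
From mathcomp Require Import all_boot all_order all_algebra.
From mathcomp Require Import all_classical all_reals all_analysis.

Set Implicit Arguments.
Unset Strict Implicit.
Unset Printing Implicit Defensive.

Import Order.TTheory GRing.Theory Num.Theory.
Import numFieldNormedType.Exports.

Local Open Scope classical_set_scope.
Local Open Scope ring_scope.

Section Euclidean.
Context {R : realType} {d : nat}.
Implicit Types (x u v : 'rV[R]_d) (A B M : set 'rV[R]_d).

Definition dot u v : R := \sum_i u 0 i * v 0 i.

(* The library norm `|u| on row vectors is the sup norm. *)
Definition enorm u : R := Num.sqrt (dot u u).

(* The distance to the empty set is +oo. *)
Definition dist x M : \bar R := ereal_inf [set (enorm (x - y))%:E | y in M].

Definition minkowski_sum A B : set 'rV[R]_d := [set u + v | u in A & v in B].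

End Euclidean.

Section ConvexAnalysis.
Context {R : realType} {d : nat}.
Implicit Types (D Sigma : set 'rV[R]_d) (f : 'rV[R]_d -> R).

(* Subdifferential at x of the function equal to f on D and to +oo off D. *)
Definition subdiff D f (x : 'rV[R]_d) : set 'rV[R]_d :=
  [set v | D x /\ forall y, D y -> f x + dot v (y - x) <= f y].

Definition normal_cone Sigma (x : 'rV[R]_d) : set 'rV[R]_d :=
  [set v | Sigma x /\ forall y, Sigma y -> dot v (y - x) <= 0].

(* The neighbourhoods are taken in the whole space and lie in the domain D
   of f, so that Sigma is contained in the interior of D. *)
Definition lipschitz_around D Sigma f : Prop :=
  forall x, Sigma x ->
    exists U, [/\ nbhs x U, U `<=` D & [lipschitz f y | y in U]].

End ConvexAnalysis.

(* D is a common domain of the four functions, containing Sigma. With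
   Sigma in the interior of D, the subdifferentials at points of Sigma do not
   contain normals to Sigma, and do not depend on the choice of D when the
   functions are convex on D. *)
Section DCProgram.
Context {R : realType} {d : nat}.
Variables (D Sigma : set 'rV[R]_d) (g0 h0 g1 h1 : 'rV[R]_d -> R).

Definition f0 (z : 'rV[R]_d) : R := g0 z - h0 z.
Definition f1 (z : 'rV[R]_d) : R := g1 z - h1 z.

Definition feasible (z : 'rV[R]_d) : Prop := Sigma z /\ f1 z <= 0.

Definition KKT_point (z : 'rV[R]_d) : Prop :=
  feasible z /\
  exists lambda : R, [/\ 0 <= lambda,
    exists u0 v0 u1 v1 n : 'rV[R]_d,
      [/\ subdiff D g0 z u0 /\ subdiff D h0 z v0,
          subdiff D g1 z u1 /\ subdiff D h1 z v1,
          normal_cone Sigma z n &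
          0 = u0 - v0 + lambda *: (u1 - v1) + n] &
    f1 z * lambda = 0].

Variables (rho delta : R) (zeta : nat -> R).
Variables (xi0 xi1 z : nat -> 'rV[R]_d) (beta : nat -> R).

Definition lin1 (k : nat) (y : 'rV[R]_d) : R :=
  g1 y - h1 (z k) - dot (xi1 k) (y - z k).

Definition phi (k : nat) (y : 'rV[R]_d) : R :=
  g0 y - h0 (z k) - dot (xi0 k) (y - z k)
  + beta k * Num.max (lin1 k y) 0
  + rho / 2 * enorm (y - z k) ^+ 2.

Definition residual (k : nat) : \bar R :=
  dist 0 (minkowski_sum (subdiff D (phi k) (z k.+1))
                        (normal_cone Sigma (z k.+1))).

Definition criterion_I (k : nat) : Prop := (residual k <= (zeta k)%:E)%E.

(* The criterion involves z^{k-1}, hence 0 < k. *)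
Definition criterion_II (k : nat) : Prop :=
  (0 < k)%N /\
  (residual k <= (Num.sqrt 2 / 2 * rho * enorm (z k - z k.-1))%:E)%E.

(* tnext k is the quantity with index k + 1. *)
Definition tnext (k : nat) : R := Num.max (lin1 k (z k.+1)) 0.

(* The inverses are those of \bar R, for which 0^-1 = +oo. *)
Definition increase_penalty (k : nat) : bool :=
  (maxe (beta k)%:E (tnext k)%:E^-1 < (enorm (z k.+1 - z k))%:E^-1)%E.

(* The criterion may be chosen anew at each iteration; in particular, the same
   one may be used throughout. *)
Record iPDCA : Prop := {
  iPDCA_rho : 0 < rho ;
  iPDCA_delta : 0 < delta ;
  iPDCA_beta0 : 0 < beta 0%N ;
  iPDCA_zeta_ge0 : forall k, 0 <= zeta k ;
  iPDCA_zeta_sum : (\sum_(0 <= k <oo) (zeta k ^+ 2)%:E < +oo)%E ;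
  iPDCA_z : forall k, Sigma (z k) ;
  iPDCA_xi0 : forall k, subdiff D h0 (z k) (xi0 k) ;
  iPDCA_xi1 : forall k, subdiff D h1 (z k) (xi1 k) ;
  iPDCA_step : forall k, criterion_I k \/ criterion_II k ;
  iPDCA_beta : forall k,
    beta k.+1 = if increase_penalty k then beta k + delta else beta k
}.

End DCProgram.

(* Main.v *)
Require Import Defs.
From HB Require Import structures.
From mathcomp Require Import all_boot all_order all_algebra.
From mathcomp Require Import all_classical all_reals all_analysis.
From mathcomp Require Import ring lra.

(** The algorithm minimizes, up to a tolerance, a convex model of the penalized
objective f0 + beta * max(f1, 0); convergence is a descent argument followed
by a passage to the limit and one application of a multiplier rule.

Descent. Let C_k be the model without its proximal term. A subgradient of
C_k + (rho/2)|. - z_k|^2 at z_(k+1), minus the gradient of the proximal term,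
is a subgradient of C_k ([subdiff_sub_sqr]). Hence the residual criterion
gives, for every y in Sigma,
  C_k(z_(k+1)) <= C_k(y) + rho <z_(k+1) - z_k, y - z_(k+1)>
                  + r_k |y - z_(k+1)|
([approximate_model_minimality]), where the single tolerance
r_k = sqrt(zeta_k^2 + (rho^2/2) |z_k - z_(k-1)|^2) covers both criteria. Since
C_k dominates the penalized objective F and agrees with it at z_k, the choice
y = z_k and the arithmetic-geometric inequality yield
  F(z_(k+1)) + (rho/2) |z_(k+1) - z_k|^2
    <= F(z_k) + (rho/4) |z_k - z_(k-1)|^2 + zeta_k^2 / (2 rho)
([penalized_decrease]). A bounded penalty sequence with increments 0 or delta
is eventually constant, so F is eventually a fixed function, bounded below on
Sigma. The quantity F(z_k) + (rho/4) |z_k - z_(k-1)|^2 then decreases, up to a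
summable error, by at least (rho/4) |z_(k+1) - z_k|^2, and the steps tend to 0
([step_cvg0]). As the penalty is no longer increased and 1/|step| eventually
exceeds beta, the update rule forces t_(k+1) <= |z_(k+1) - z_k|
([tnext_le_step]), so accumulation points are feasible.

Limit. Let x be an accumulation point. Local Lipschitz continuity bounds the
subgradients xi_i^k near x, so along a suitable filter z_k tends to x and the
xi_i^k tend to subgradients v_i of h_i at x ([subgradients_cluster]). In the
displayed inequality every error term vanishes, and x minimizes over Sigma the
function p + beta max(q, 0), with p = g0 - <v0, .> and
q = g1 - h1(x) - <v1, . - x> convex and q(x) = f1(x) <= 0
([limit_model_minimality]).

Multipliers. It remains to split this minimality into subgradients a of p and
b of q, a normal n and lambda >= 0 with a + lambda b + n = 0 and
lambda q(x) = 0 ([exact_penalty_multiplier]). All of them are read off from a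
single linear minorant, given by the Hahn-Banach theorem, of the value of the
problem in which p, q and the constraint level are perturbed independently.
The Hahn-Banach theorem is proved in finite dimension, one basis vector at a
time ([epi_cone_minorant]). *)

Set Implicit Arguments.
Unset Strict Implicit.
Unset Printing Implicit Defensive.

Import Order.TTheory GRing.Theory Num.Theory.
Import numFieldNormedType.Exports.

Local Open Scope classical_set_scope.
Local Open Scope ring_scope.

(** * The Euclidean inner product *)

Section InnerProduct.
Context {R : realType} {d : nat}.
Implicit Types (u v w : 'rV[R]_d) (a : R).

Lemma dotC u v : dot u v = dot v u.
Proof. by apply: eq_bigr => i _; rewrite mulrC. Qed.

Lemma dotDl u v w : dot (u + v) w = dot u w + dot v w.
Proof. by rewrite -big_split; apply: eq_bigr => i _; rewrite mxE mulrDl. Qed.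

Lemma dotZl a u v : dot (a *: u) v = a * dot u v.
Proof. by rewrite mulr_sumr; apply: eq_bigr => i _; rewrite mxE mulrA. Qed.

Lemma dotNl u v : dot (- u) v = - dot u v.
Proof. by rewrite -scaleN1r dotZl mulN1r. Qed.

Lemma dotBl u v w : dot (u - v) w = dot u w - dot v w.
Proof. by rewrite dotDl dotNl. Qed.

Lemma dotDr u v w : dot u (v + w) = dot u v + dot u w.
Proof. by rewrite dotC dotDl !(dotC u). Qed.

Lemma dotZr a u v : dot u (a *: v) = a * dot u v.
Proof. by rewrite dotC dotZl dotC. Qed.

Lemma dotNr u v : dot u (- v) = - dot u v.
Proof. by rewrite dotC dotNl dotC. Qed.

Lemma dotBr u v w : dot u (v - w) = dot u v - dot u w.
Proof. by rewrite dotDr dotNr. Qed.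

Lemma dot0l v : dot 0 v = 0.
Proof. by rewrite -(scale0r 0) dotZl mul0r. Qed.

Lemma dot0r v : dot v 0 = 0.
Proof. by rewrite dotC dot0l. Qed.

Lemma dot_deltar u (i : 'I_d) : dot u (delta_mx 0 i) = u 0 i.
Proof.
rewrite /dot (bigD1 i)//= mxE !eqxx mulr1 big1 ?addr0// => j ji.
by rewrite mxE (negbTE ji) andbF mulr0.
Qed.

Lemma dot_ge0 u : 0 <= dot u u.
Proof. by apply: sumr_ge0 => i _; rewrite -expr2 sqr_ge0. Qed.

Lemma enorm_ge0 u : 0 <= enorm u.
Proof. exact: sqrtr_ge0. Qed.

Lemma enorm_sqr u : enorm u ^+ 2 = dot u u.
Proof. by rewrite sqr_sqrtr ?dot_ge0. Qed.

Lemma enorm0 : enorm (0 : 'rV[R]_d) = 0.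
Proof. by rewrite /enorm dot0l sqrtr0. Qed.

Lemma enormN u : enorm (- u) = enorm u.
Proof. by rewrite /enorm dotNl dotNr opprK. Qed.

Lemma coord_le_enorm u (i : 'I_d) : `|u 0 i| <= enorm u.
Proof.
rewrite -sqrtr_sqr ler_wsqrtr// /dot (bigD1 i)//= -expr2 lerDl.
by apply: sumr_ge0 => j _; rewrite -expr2 sqr_ge0.
Qed.

Lemma enorm_eq0 u : enorm u = 0 -> u = 0.
Proof.
move=> u0; apply/rowP => i; rewrite mxE; apply/eqP.
by rewrite -normr_le0 -u0 coord_le_enorm.
Qed.

Lemma enorm_gt0 u : u != 0 -> 0 < enorm u.
Proof.
move=> u0; rewrite lt_neqAle enorm_ge0 andbT eq_sym.
by apply: contraNneq u0 => /enorm_eq0 ->.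
Qed.

(** Cauchy-Schwarz, from the nonnegativity of the square of
    [|v| *: u + |u| *: v]. *)
Lemma dot_ge_enorm u v : - (enorm u * enorm v) <= dot u v.
Proof.
have [->|u0] := eqVneq u 0; first by rewrite dot0l enorm0 mul0r oppr0.
have [->|v0] := eqVneq v 0; first by rewrite dot0r enorm0 mulr0 oppr0.
have := dot_ge0 (enorm v *: u + enorm u *: v).
rewrite dotDl !dotDr !dotZl !dotZr -!enorm_sqr (dotC v u).
have := enorm_gt0 u0; have := enorm_gt0 v0.
set a := enorm u; set b := enorm v; set c := dot u v => b0 a0 H.
have : 0 <= (2 * a * b) * (a * b + c) by nra.
by rewrite pmulr_rge0; [lra | nra].
Qed.

Lemma norm_le_enorm u : `|u| <= enorm u.
Proof.
rewrite [leLHS]/Num.norm /= mx_normrE; apply: bigmax_le; first exact: enorm_ge0.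
by move=> [i j] _ /=; rewrite (ord1 i) coord_le_enorm.
Qed.

End InnerProduct.

(** * The Hahn-Banach theorem in finite dimension *)

Section Minorants.
Context {R : realType}.

Lemma le_of_small_slack (x y K : R) :
  (forall t, 0 < t -> t <= 1 -> x <= y + t * K) -> x <= y.
Proof.
move=> H; apply/ler_addgt0Pr => e e0.
have t0 : 0 < Num.min 1 (e / (`|K| + 1)).
  by rewrite lt_min ltr01 divr_gt0// ltr_wpDl.
apply: le_trans (H _ t0 _) _; first by rewrite ge_min lexx.
rewrite lerD2l; apply: le_trans (ler_wpM2l (ltW t0) (ler_norm K)) _.
have K1 : 0 < `|K| + 1 by rewrite ltr_wpDl.
have : Num.min 1 (e / (`|K| + 1)) <= e / (`|K| + 1) by rewrite ge_min lexx orbT.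
rewrite ler_pdivlMr// => le_e; apply: le_trans _ le_e.
by rewrite ler_wpM2l ?lerDl// ltW.
Qed.

Section Cones.
Context {V : lmodType R}.
Implicit Types (K : V -> R -> Prop) (u v : V) (a b c t : R).

(** [K v a] reads: a is an upper bound on the value at v. The infimum of these
    bounds is a finite sublinear function of v; keeping the relation avoids
    handling that infimum. *)
Record epi_cone K : Prop := EpiCone {
  epi_coneD : forall u v a b, K u a -> K v b -> K (u + v) (a + b);
  epi_coneZ : forall t v a, 0 < t -> K v a -> K (t *: v) (t * a);
  epi_cone_total : forall v, exists a, K v a;
  epi_cone_pointed : forall a, K 0 a -> 0 <= a }.

(** A sublinear function is minorized on a line by a linear form: any slope
    between - K(- e) and K(e) works, and the largest one is taken. *)
Lemma epi_cone_slope K e : epi_cone K ->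
  exists c, forall t a, K (t *: e) a -> t * c <= a.
Proof.
move=> KK.
have ub b : K (- e) b -> lbound [set a | K e a] (- b).
  move=> Kb a /= Ka; rewrite lerNl -subr_ge0 opprK.
  by apply: (epi_cone_pointed KK); rewrite -(addNr e); apply: epi_coneD.
have [b0 Kb0] := epi_cone_total KK (- e).
have [a0 Ka0] := epi_cone_total KK e.
have inf_lb : has_inf [set a | K e a].
  by split; [exists a0|exists (- b0); exact: ub].
exists (inf [set a | K e a]) => t a Kt.
have [t0|t0|t0] := ltrgtP t 0.
- have Kt' : K (- e) (- t^-1 * a).
    have -> : - e = (- t^-1) *: (t *: e).
      by rewrite scalerA mulNr mulVf ?lt_eqF// scaleN1r.
    by apply: epi_coneZ => //; rewrite oppr_gt0 invr_lt0.
  have := lb_le_inf inf_lb.1 (ub _ Kt'); rewrite mulNr opprK => H.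
  by rewrite -(ler_nM2l (x := t^-1)) ?invr_lt0// mulKf ?lt_eqF.
- have Ka : K e (t^-1 * a).
    have -> : e = t^-1 *: (t *: e) by rewrite scalerA mulVf ?gt_eqF// scale1r.
    by apply: epi_coneZ => //; rewrite invr_gt0.
  have : inf [set a | K e a] <= t^-1 * a.
    by apply: ge_inf => //; exact: inf_lb.2.
  by rewrite ler_pdivlMl.
- move: Kt; rewrite t0 scale0r mul0r.
  exact: (epi_cone_pointed KK).
Qed.

(** Once the slope c along e is chosen, K can be replaced by its sum with the
    line through (e, c): a linear minorant of the sum minorizes K and takes the
    value c at e. *)
Lemma epi_cone_collapse K e c : epi_cone K ->
  (forall t a, K (t *: e) a -> t * c <= a) ->
  epi_cone (fun v a => exists t, K (v + t *: e) (a + t * c)).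
Proof.
move=> KK Kc; split.
- move=> u v a b [t Kt] [s Ks]; exists (t + s).
  by rewrite scalerDl (addrACA u) mulrDl (addrACA a); apply: epi_coneD.
- move=> t v a t0 [s Ks]; exists (t * s).
  by rewrite -scalerA -scalerDr -mulrA -mulrDr; apply: epi_coneZ.
- move=> v; have [a Ka] := epi_cone_total KK v; exists a, 0.
  by rewrite scale0r mul0r !addr0.
- by move=> a [t]; rewrite add0r => /Kc; rewrite lerDr.
Qed.

Lemma epi_cone_slopes K (e : nat -> V) n : epi_cone K ->
  exists c : nat -> R, forall (t : nat -> R) a,
    K (\sum_(i < n) t i *: e i) a -> \sum_(i < n) t i * c i <= a.
Proof.
elim: n K e => [|n IH] K e KK.
  by exists (fun=> 0) => t a; rewrite !big_ord0; apply: epi_cone_pointed.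
have [c0 Kc0] := epi_cone_slope (e 0%N) KK.
have [c Kc] := IH _ (fun i => e i.+1) (epi_cone_collapse KK Kc0).
exists (fun i => if i is j.+1 then c j else c0) => t a.
rewrite !big_ord_recl/= => Ka; rewrite addrC -lerBrDr.
apply: (Kc (fun i => t i.+1)); exists (t 0%N).
by rewrite addrC subrK.
Qed.

End Cones.

(** The finite-dimensional Hahn-Banach theorem: the slopes are chosen along the
    vectors of a basis. *)
Lemma epi_cone_minorant (V : vectType R) (K : V -> R -> Prop) : epi_cone K ->
  exists f : {linear V -> R^o}, forall v a, K v a -> f v <= a.
Proof.
move=> KK; pose b := vbasis (@fullv R V).
have [c Kc] := epi_cone_slopes (fun i => b`_i) (\dim (@fullv R V)) KK.
pose f (v : V) : R^o := \sum_(i < \dim (@fullv R V)) coord b i v * c i.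
have flin : linear f.
  move=> t u v; rewrite /f scaler_sumr -big_split; apply: eq_bigr => i _ /=.
  by rewrite linearP/= mulrDl -mulrA.
pose F := HB.pack f (GRing.isLinear.Build _ _ _ _ f flin) : {linear V -> R^o}.
exists F => v a Ka; rewrite /F/= /f.
have vE := coord_vbasis (memvf v).
(* the coordinates, indexed by nat *)
pose t i := if insub i is Some j then coord b j v else 0.
have tE (i : 'I_(\dim (@fullv R V))) : t i = coord b i v by rewrite /t valK.
under eq_bigr do rewrite -tE.
by apply: Kc; under eq_bigr do rewrite tE; rewrite -vE.
Qed.

(** The cone generated by a convex relation: it is total because the domain of
    the relation is absorbing, and pointed because the bounds at the origin are
    nonnegative. *)
Lemma convex_minorant (V : vectType R) (G : V -> R -> Prop) :
  (forall u v a b s t, G u a -> G v b -> 0 <= s -> 0 <= t -> s + t = 1 ->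
     G (s *: u + t *: v) (s * a + t * b)) ->
  (forall v, exists t a, 0 < t /\ G (t *: v) a) ->
  (forall a, G 0 a -> 0 <= a) ->
  exists f : {linear V -> R^o}, forall v a, G v a -> f v <= a.
Proof.
move=> Gconv Gabs G0.
have [|f Hf] := @epi_cone_minorant V
    (fun v a => exists t, 0 < t /\ G (t *: v) (t * a)); last first.
  by exists f => v a Ga; apply: Hf; exists 1; rewrite scale1r mul1r.
split.
- move=> u v a b [t [t0 Gt]] [s [s0 Gs]].
  have ts0 : 0 < t + s by rewrite addr_gt0.
  exists (t * s / (t + s)); split; first by rewrite !(mulr_gt0, invr_gt0).
  have := Gconv _ _ _ _ (s / (t + s)) (t / (t + s)) Gt Gs.
  rewrite !scalerA !mulrA scalerDr mulrDr.
  have -> : s / (t + s) * t = t * s / (t + s) by ring.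
  have -> : t / (t + s) * s = t * s / (t + s) by ring.
  apply; rewrite ?divr_ge0 ?ltW//.
  by field; rewrite gt_eqF.
- move=> t v a t0 [s [s0 Gs]]; exists (s / t); rewrite divr_gt0//; split=> //.
  by rewrite scalerA mulrA divfK ?gt_eqF.
- move=> v; have [t [a [t0 Gt]]] := Gabs v; exists (t^-1 * a), t.
  by rewrite mulVKf ?gt_eqF.
- move=> a [t [t0]]; rewrite scaler0 => /G0.
  by rewrite pmulr_rge0.
Qed.

End Minorants.

(** * Subgradients and multipliers *)

Section Subgradients.
Context {R : realType} {d : nat}.
Implicit Types (D Sigma : set 'rV[R]_d) (p q : 'rV[R]_d -> R).
Implicit Types (x y u v w : 'rV[R]_d) (s t : R).

Lemma convex_setP D : convex_set D <-> forall x y s t,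
  D x -> D y -> 0 <= s -> 0 <= t -> s + t = 1 -> D (s *: x + t *: y).
Proof.
split=> [cD x y s t Dx Dy s0 t0 st1|cD x y l].
  have s01 : 0 <= s <= 1 by rewrite s0 -st1 lerDl.
  have := cD x y (Itv01 s0 (proj2 (andP s01))).
  rewrite !inE => /(_ Dx Dy); rewrite /conv/=.
  by have -> : t = 1 - s by rewrite -st1 addrC addKr.
rewrite !inE => Dx Dy; apply: cD => //; rewrite ?ge0//.
  by rewrite subr_ge0 le1.
exact: unstable.add_onemK.
Qed.

Lemma convex_functionP D p : convex_function D p <-> forall x y s t,
  D x -> D y -> 0 <= s -> 0 <= t -> s + t = 1 ->
  p (s *: x + t *: y) <= s * p x + t * p y.
Proof.
split=> [cp x y s t Dx Dy s0 t0 st1|cp l x y].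
  have s01 : 0 <= s <= 1 by rewrite s0 -st1 lerDl.
  have := cp (Itv01 s0 (proj2 (andP s01))) x y.
  rewrite !inE => /(_ Dx Dy); rewrite /conv/=.
  by have -> : t = 1 - s by rewrite -st1 addrC addKr.
rewrite !inE => Dx Dy; apply: cp => //; rewrite ?ge0//.
  by rewrite subr_ge0 le1.
exact: unstable.add_onemK.
Qed.

Lemma max0_convex (a b c s t : R) : 0 <= s -> 0 <= t -> c <= s * a + t * b ->
  Num.max c 0 <= s * Num.max a 0 + t * Num.max b 0.
Proof.
move=> s0 t0 cab; rewrite ge_max; apply/andP; split; last first.
  by rewrite addr_ge0// mulr_ge0// le_max lexx orbT.
by apply: le_trans cab _; rewrite lerD// ler_wpM2l// le_max lexx.
Qed.

Lemma nbhs_absorbing D x v : nbhs x D -> exists t, 0 < t /\ D (x + t *: v).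
Proof.
move=> /nbhs_normP[e /= e0 De].
have v1 : 0 < `|v| + 1 by rewrite ltr_wpDl.
exists (e / (`|v| + 1)); rewrite divr_gt0//; split=> //; apply: De => /=.
rewrite opprD addNKr normrN normrZ gtr0_norm ?divr_gt0//.
by rewrite mulrAC ltr_pdivrMr// ltr_pM2l// ltrDl.
Qed.

Lemma linear_form_dot (f : {linear 'rV[R]_d -> R^o}) :
  exists a : 'rV[R]_d, forall x, f x = dot a x.
Proof.
exists (\row_i f (delta_mx 0 i)) => x.
rewrite {1}(row_sum_delta x) linear_sum; apply: eq_bigr => i _.
by rewrite linearZ mxE mulrC.
Qed.

(** A linear minorant of y |-> p(x + y) - p(x). *)
Lemma subdiff_nonempty D p x : convex_set D -> convex_function D p ->
  nbhs x D -> subdiff D p x !=set0.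
Proof.
move=> /convex_setP cD /convex_functionP cp Dnx.
have Dx := nbhs_singleton Dnx.
have [|||f Hf] := @convex_minorant R 'rV[R]_d
    (fun v a => D (x + v) /\ p (x + v) - p x <= a).
- move=> u v a b s t [Du ua] [Dv va] s0 t0 st1.
  have -> : x + (s *: u + t *: v) = s *: (x + u) + t *: (x + v).
    by rewrite !scalerDr addrACA -scalerDl st1 scale1r.
  split; first exact: cD.
  have := cp _ _ _ _ Du Dv s0 t0 st1.
  have : s * p x + t * p x = p x by rewrite -mulrDl st1 mul1r.
  have := ler_wpM2l s0 ua; have := ler_wpM2l t0 va; lra.
- move=> v; have [t [t0 Dt]] := nbhs_absorbing v Dnx.
  by exists t, (p (x + t *: v) - p x).
- by move=> a []; rewrite addr0 subrr.
- have [a fE] := linear_form_dot f; exists a; split=> // y Dy.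
  have := Hf (y - x) (p y - p x); rewrite fE.
  have -> : x + (y - x) = y by rewrite addrC subrK.
  by move=> /(_ (conj Dy (lexx _))); lra.
Qed.

(** The perturbed problem has value
    inf over w in Sigma of p(w + u) - p(x) + beta max(q(w + v) + r, 0),
    jointly convex in (u, v, r) and at least 0 at the origin by minimality of
    x. A linear minorant (u, v, r) |-> <a, u> + <b, v> + lambda r of it carries
    every multiplier: w = x gives the subgradient inequalities, and
    u = v = x - w gives that - (a + b) is normal to Sigma. Perturbing the
    constraint level by r separates the weight lambda from the subgradient of
    q, so no rule for the subdifferential of a maximum is used. *)
Lemma exact_penalty_multiplier Sigma D p q beta x :
  convex_set Sigma -> convex_set D -> nbhs x D ->
  convex_function D p -> convex_function D q ->
  0 <= beta -> Sigma x -> q x <= 0 ->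
  (forall y, Sigma y -> p x <= p y + beta * Num.max (q y) 0) ->
  exists lambda a b n, [/\ 0 <= lambda, lambda * q x = 0,
    subdiff D p x a /\ subdiff D q x b, normal_cone Sigma x n &
    a + lambda *: b + n = 0].
Proof.
move=> /convex_setP cS cD' Dnx /convex_functionP cp cq' b0 Sx qx0 pmin.
move: (cD') (cq') => /convex_setP cD /convex_functionP cq.
have Dx := nbhs_singleton Dnx.
pose F w u v r := p (w + u) - p x + beta * Num.max (q (w + v) + r) 0.
have [|||f Hf] := @convex_minorant R ('rV[R]_d * 'rV[R]_d * R^o)%type
    (fun e a => exists w, [/\ Sigma w, D (w + e.1.1), D (w + e.1.2) &
       F w e.1.1 e.1.2 e.2 <= a]).
- move=> [[u1 v1] r1] [[u2 v2] r2] a1 a2 s t /=.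
  move=> [w1 [Sw1 Du1 Dv1 F1]] [w2 [Sw2 Du2 Dv2 F2]] s0 t0 st1.
  exists (s *: w1 + t *: w2).
  have E (z1 z2 : 'rV[R]_d) : s *: w1 + t *: w2 + (s *: z1 + t *: z2) =
      s *: (w1 + z1) + t *: (w2 + z2) by rewrite !scalerDr addrACA.
  rewrite /F !E; split; [exact: cS|exact: cD|exact: cD|].
  have Hp := cp _ _ _ _ Du1 Du2 s0 t0 st1.
  have Hq := cq _ _ _ _ Dv1 Dv2 s0 t0 st1.
  have Hx : s * p x + t * p x = p x by rewrite -mulrDl st1 mul1r.
  have Hm : Num.max (q (s *: (w1 + v1) + t *: (w2 + v2)) + (s * r1 + t * r2)) 0
      <= s * Num.max (q (w1 + v1) + r1) 0 + t * Num.max (q (w2 + v2) + r2) 0.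
    by apply: max0_convex => //; lra.
  have := ler_wpM2l b0 Hm.
  have := ler_wpM2l s0 F1; have := ler_wpM2l t0 F2; rewrite /F; lra.
- move=> [[u v] r].
  have [t1 [t10 Du]] := nbhs_absorbing u Dnx.
  have [t2 [t20 Dv]] := nbhs_absorbing v Dnx.
  (* by convexity of D the smaller of the two radii serves both vectors *)
  pose t := Num.min t1 t2.
  have t0 : 0 < t by rewrite lt_min t10.
  have seg t' z : 0 < t' -> t <= t' -> D (x + t' *: z) -> D (x + t *: z).
    move=> t'0 tt' Dz.
    have -> : x + t *: z = (1 - t / t') *: x + (t / t') *: (x + t' *: z).
      rewrite scalerDr scalerA divfK ?gt_eqF// addrA -scalerDl.
      by rewrite subrK scale1r.
    apply: cD => //; last by rewrite subrK.
      by rewrite subr_ge0 ler_pdivrMr// mul1r.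
    by rewrite divr_ge0// ltW.
  exists t, (F x (t *: u) (t *: v) (t * r)); split => //.
  exists x; split => //=.
    by apply: (seg t1) => //; rewrite /t ge_min lexx.
  by apply: (seg t2) => //; rewrite /t ge_min lexx orbT.
- move=> a [w [Sw _ _]]; rewrite /F /= !addr0; apply: le_trans.
  by have := pmin _ Sw; lra.
pose fa (u : 'rV[R]_d) : R^o := f (u, 0, 0).
pose fb (u : 'rV[R]_d) : R^o := f (0, u, 0).
have fa_lin : linear fa.
  move=> k u v; rewrite -linearP; congr (f _).
  by do 2?apply: injective_projections => //=; rewrite scaler0 addr0.
have fb_lin : linear fb.
  move=> k u v; rewrite -linearP; congr (f _).
  by do 2?apply: injective_projections => //=; rewrite scaler0 addr0.
have [a aE] := linear_form_dot
  (HB.pack fa (GRing.isLinear.Build _ _ _ _ fa fa_lin) : {linear _ -> R^o}).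
have [b bE] := linear_form_dot
  (HB.pack fb (GRing.isLinear.Build _ _ _ _ fb fb_lin) : {linear _ -> R^o}).
pose lambda : R := f (0, 0, 1).
have fE u v r : f (u, v, r) = dot a u + dot b v + lambda * r.
  rewrite -aE -bE /= /fa /fb /lambda.
  have -> : f (0, 0, 1) * r = f (r *: (0, 0, 1)) :> R.
    by rewrite linearZ mulrC.
  rewrite -!linearD; congr (f _).
  do 2?apply: injective_projections => /=; rewrite ?scaler0 ?addr0 ?add0r //.
  by rewrite /GRing.scale /= mulr1.
have key w u v r : Sigma w -> D (w + u) -> D (w + v) ->
    dot a u + dot b v + lambda * r <= F w u v r.
  by move=> Sw Du Dv; rewrite -fE; apply: Hf; exists w.
have xE y : x + (y - x) = y by rewrite addrC subrK.
have lam_r r : lambda * r <= beta * Num.max (q x + r) 0.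
  have := key x 0 0 r Sx; rewrite /F !addr0 !dot0r !add0r subrr add0r.
  exact.
(* with a slack r <= - q x the penalty vanishes *)
have lam0 : 0 <= lambda.
  have := lam_r (-1); rewrite [Num.max _ _]max_r ?mulr0; last lra.
  lra.
have lamq : lambda * q x = 0.
  have := lam_r (- q x); rewrite subrr maxxx mulr0.
  have := mulr_ge0_le0 lam0 qx0; lra.
have Da : subdiff D p x a.
  split=> // y Dy.
  have := key x (y - x) 0 (- q x) Sx; rewrite /F xE !addr0 dot0r addr0.
  move=> /(_ Dy Dx); rewrite subrr maxxx; lra.
have Db y : D y -> dot b (y - x) <= lambda * q y.
  move=> Dy; have := key x 0 (y - x) (- q y) Sx.
  rewrite /F xE !addr0 dot0r !subrr maxxx => /(_ Dx Dy); lra.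
have Nn : normal_cone Sigma x (- (a + b)).
  split=> // w Sw; have := key w (x - w) (x - w) 0 Sw.
  rewrite /F; have -> : w + (x - w) = x by rewrite addrC subrK.
  move=> /(_ Dx Dx); rewrite addr0 [Num.max _ _]max_r// !dotBr dotNl dotDl.
  by rewrite dotNl dotDl; lra.
have [lam_eq0|lam_neq0] := eqVneq lambda 0.
- (* <b, .> is nonpositive around the origin, hence b = 0; any subgradient of q
     can carry the weight 0 *)
  have b_eq0 : b = 0.
    have [t [t0 Dt]] := nbhs_absorbing b Dnx.
    apply: enorm_eq0; apply/eqP; rewrite -sqrf_eq0 enorm_sqr.
    have := Db _ Dt; rewrite lam_eq0 mul0r addrAC subrr add0r dotZr.
    rewrite pmulr_rle0// => bb; apply/eqP/le_anti.
    by rewrite bb dot_ge0.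
  have [b' Db'] := subdiff_nonempty cD' cq' Dnx.
  exists lambda, a, b', (- (a + b)); split=> //.
  by rewrite lam_eq0 scale0r b_eq0 !addr0 subrr.
- exists lambda, a, (lambda^-1 *: b), (- (a + b)); split=> //; last first.
    by rewrite scalerA divff// scale1r subrr.
  split=> //; split=> // y Dy.
  have lam_gt0 : 0 < lambda by rewrite lt_neqAle eq_sym lam_neq0.
  rewrite dotZl -(ler_pM2l lam_gt0) mulrDr mulVKf// lamq add0r.
  exact: Db.
Qed.

(** Along the segment x + t (y - x) the square contributes its linear part,
    of order t, and an error of order t^2; dividing by t and letting t tend to
    0 removes the error. The case of a proximal term both gives strong
    convexity and removes that term from the limit problem. *)
Lemma subdiff_sub_sqr D C c a x u : convex_set D -> convex_function D C ->
  subdiff D (fun y => C y + c * enorm (y - a) ^+ 2) x u ->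
  subdiff D C x (u - (2 * c) *: (x - a)).
Proof.
move=> /convex_setP cD /convex_functionP cC [Dx Hu]; split=> // y Dy.
apply: (@le_of_small_slack _ _ _ (c * dot (y - x) (y - x))) => t t0 t1.
have t1' : 0 <= 1 - t by rewrite subr_ge0.
have H1 : 1 - t + t = 1 by rewrite subrK.
have H := Hu _ (cD _ _ _ _ Dx Dy t1' (ltW t0) H1).
have H2 := cC _ _ _ _ Dx Dy t1' (ltW t0) H1.
have E : (1 - t) *: x + t *: y = x + t *: (y - x).
  by rewrite scalerBl scale1r scalerBr addrAC addrA.
move: H H2; rewrite E !enorm_sqr.
have -> : x + t *: (y - x) - x = t *: (y - x) by rewrite addrAC subrr add0r.
have -> : x + t *: (y - x) - a = (x - a) + t *: (y - x) by rewrite addrAC.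
move: (y - x) (x - a) => e b; rewrite dotBl dotZl dotZr.
have -> : dot (b + t *: e) (b + t *: e) =
    dot b b + 2 * t * dot b e + t * (t * dot e e).
  by rewrite dotDl !dotDr !(dotZl, dotZr) (dotC e b); ring.
move=> H H2.
rewrite -(ler_pM2l t0); nra.
Qed.

End Subgradients.

(** * Limits *)

Section Limits.
Context {R : realType}.

(** Refining the filter plays the role of extracting a subsequence: the traces
    on members of F of the inverse images of neighbourhoods of p form a base. *)
Lemma cluster_refine (T : Type) (V : topologicalType) (F : set_system T)
    (f : T -> V) (p : V) : ProperFilter F -> cluster (f @ F) p ->
  exists G : set_system T, [/\ ProperFilter G, F `<=` G & f @ G --> p].
Proof.
move=> FF Fp.
pose B (P : set T * set V) := P.1 `&` f @^-1` P.2.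
pose DB := [set P : set T * set V | F P.1 /\ nbhs p P.2].
exists (filter_from DB B); split.
- apply: filter_from_proper.
    apply: filter_from_filter.
      by exists (setT, setT); split=> /=; exact: filterT.
    move=> [P1 P2] [Q1 Q2] [/= FP1 nP2] [/= FQ1 nQ2].
    exists (P1 `&` Q1, P2 `&` Q2); first by split; exact: filterI.
    by move=> t [] [? ?] [? ?].
  move=> [P1 P2] [/= FP1 nP2].
  have FfP1 : F (f @^-1` (f @` P1)).
    by apply: (filterS _ FP1) => t P1t; exists t.
  by have [_ [[t P1t <-] P2t]] := Fp _ _ FfP1 nP2; exists t.
- by move=> P FP; exists (P, setT) => [|t []//]; split=> //=; exact: filterT.
- by move=> P nP; exists (setT, P) => [|t []//]; split=> //=; exact: filterT.
Qed.

(** E n minus the partial sums of s is eventually nonincreasing and bounded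
    below, so it converges; a n is at most its decrease at n. *)
Lemma almost_decreasing_gap_cvg0 (E a s : nat -> R) :
  (forall n, 0 <= a n) ->
  (\forall n \near \oo, E n.+1 + a n <= E n + s n) ->
  (exists M, forall n, \sum_(0 <= k < n) s k <= M) ->
  (exists m, forall n, m <= E n) ->
  a @ \oo --> 0.
Proof.
move=> a0 [K _ Ea] [M sM] [m mE]; pose w n := E n - \sum_(0 <= k < n) s k.
have wS n : (K <= n)%N -> a n <= w n - w n.+1.
  by move=> Kn; rewrite /w big_nat_recr//=; have := Ea _ Kn; rewrite /=; lra.
have cw : cvgn w.
  apply: (@near_nonincreasing_is_cvgn _ _ (m - M)).
    exists K => // n /= Kn j nj; rewrite -(subnK nj).
    elim: (j - n)%N => // i IH; apply: le_trans _ IH; rewrite addSn.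
    have := wS (i + n)%N (leq_trans Kn (leq_addl _ _)).
    by have := a0 (i + n)%N; lra.
  by apply: nearW => n; rewrite /w; have := mE n; have := sM n; lra.
apply: (@squeeze_cvgr _ _ _ _ (fun=> 0) (fun n => w n - w n.+1)).
- by exists K => // n /= Kn; rewrite a0 wS.
- exact: cvg_cst.
- rewrite -(subrr (limn w)); apply: cvgB => //.
  by rewrite cvg_shiftS.
Qed.

Lemma cvg0_sqr (T : Type) (F : set_system T) (u : T -> R) : Filter F ->
  (forall n, 0 <= u n) -> (fun n => u n ^+ 2) @ F --> 0 -> u @ F --> 0.
Proof.
move=> FF u0 cu; rewrite -(@sqrtr0 R).
rewrite (_ : u = fun n => Num.sqrt (u n ^+ 2)).
  exact: (cvg_comp _ _ cu (@sqrt_continuous R 0)).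
by apply/funext => n; rewrite sqrtr_sqr ger0_norm.
Qed.

Section Vectors.
Context {d : nat} {T : Type} (F : set_system T) {FF : Filter F}.
Implicit Types (u v : T -> 'rV[R]_d) (a b : 'rV[R]_d).

Lemma cvg_dot u v a b : u @ F --> a -> v @ F --> b ->
  (fun n => dot (u n) (v n)) @ F --> dot a b.
Proof.
move=> ua vb; rewrite /dot; apply: cvg_big => [|i _].
  by move=> [x y]; exact: add_continuous.
by apply: cvgM; [exact: (cvg_comp _ _ ua (@coord_continuous _ _ _ _ _ _))|
  exact: (cvg_comp _ _ vb (@coord_continuous _ _ _ _ _ _))].
Qed.

Lemma cvg_enorm u a : u @ F --> a -> (fun n => enorm (u n)) @ F --> enorm a.
Proof.
move=> ua.
exact: (cvg_comp _ _ (cvg_dot ua ua) (@sqrt_continuous R (dot a a))).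
Qed.

Lemma cvg0_enorm u :
  (fun n => enorm (u n)) @ F --> 0 -> u @ F --> (0 : 'rV[R]_d).
Proof.
move=> /cvgrPdist_lt u0; apply/cvgrPdist_lt => e /u0.
apply: filterS => n; rewrite !sub0r !normrN ger0_norm ?enorm_ge0//.
exact/le_lt_trans/norm_le_enorm.
Qed.

End Vectors.

End Limits.

Section LocallyLipschitz.
Context {R : realType} {d : nat}.
Implicit Types (D Sigma : set 'rV[R]_d) (f h : 'rV[R]_d -> R).

Lemma lipschitz_aroundP D Sigma f x : lipschitz_around D Sigma f -> Sigma x ->
  exists M e, [/\ 0 < e, 0 <= M, forall y, `|x - y| < e -> D y &
    forall y y', `|x - y| < e -> `|x - y'| < e ->
      `|f y - f y'| <= M * `|y - y'|].
Proof.
move=> fL Sx; have [U [nU UD [M [_ UM]]]] := fL _ Sx.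
have /nbhs_normP[e /= e0 eU] := nU.
exists (`|M| + 1), e; split=> [//|//|y xy|y y' xy xy']; first exact/UD/eU.
have := UM (`|M| + 1); rewrite ltr_pwDr ?ler_norm// => /(_ isT).
by move=> /(_ (y, y')); apply; split; exact: eU.
Qed.

Lemma lipschitz_around_continuous D Sigma f x :
  lipschitz_around D Sigma f -> Sigma x -> {for x, continuous f}.
Proof.
move=> fL Sx; have [M [e [e0 _ _ fM]]] := lipschitz_aroundP fL Sx.
apply/(@cvgrPdist_lt _ _ _ (nbhs x)) => /= eps eps0.
have M0 : 0 < `|M| + 1 by rewrite ltr_wpDl.
apply/(@nbhs_normP R 'rV[R]_d); exists (Num.min e (eps / (`|M| + 1))) => /=.
  by rewrite lt_min e0 divr_gt0.
move=> y; rewrite /ball_/= lt_min => /andP[ye yeps].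
apply: le_lt_trans (fM _ _ _ ye) _; first by rewrite subrr normr0.
move: yeps; rewrite ltr_pdivlMr// mulrC; apply: le_lt_trans.
by rewrite ler_wpM2r// ler_wpDr// ler_norm.
Qed.

(** Testing the subgradient inequality at x + s w, with w of sup norm at most
    1, gives <xi, w> <= M; the signed basis vectors then bound the entries of
    xi. The norms are sup norms throughout. *)
Lemma subdiff_le_lipschitz D h x xi M s :
  0 < s -> 0 <= M -> subdiff D h x xi ->
  (forall y, `|y - x| <= s -> D y /\ `|h y - h x| <= M * `|y - x|) ->
  `|xi| <= M.
Proof.
move=> s0 M0 [_ Hxi] hM.
have H (w : 'rV[R]_d) : `|w| <= 1 -> dot xi w <= M.
  move=> w1; have E : x + s *: w - x = s *: w by rewrite addrAC subrr add0r.
  have sw : `|s *: w| <= s by rewrite normrZ gtr0_norm// ler_piMr// ltW.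
  have [|Dy My] := hM (x + s *: w); first by rewrite E.
  have := Hxi _ Dy; rewrite E dotZr in My *.
  have := le_trans My (ler_wpM2l M0 sw); rewrite ler_norml => /andP[_].
  by move=> h1 h2; rewrite -(ler_pM2l s0); lra.
rewrite [leLHS]/Num.norm /= mx_normrE; apply: bigmax_le => // -[i j] _ /=.
rewrite (ord1 i) -dot_deltar.
have d1 : `|delta_mx 0 j : 'rV[R]_d| <= 1.
  apply: le_trans (norm_le_enorm _) _.
  by rewrite /enorm dot_deltar mxE !eqxx sqrtr1.
by rewrite ler_norml H// andbT lerNl -dotNr H// normrN.
Qed.

(** Subgradients at points near x are bounded by the Lipschitz constant, hence
    accumulate, and the graph of the subdifferential is closed because h is
    continuous at x. *)
Lemma subgradients_cluster (F : set_system nat) D Sigma h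
    (z xi : nat -> 'rV[R]_d) x : ProperFilter F ->
  lipschitz_around D Sigma h -> Sigma x -> z @ F --> x ->
  (forall n, subdiff D h (z n) (xi n)) ->
  exists G v, [/\ ProperFilter G, F `<=` G, xi @ G --> v & subdiff D h x v].
Proof.
move=> FF hL Sx zx Hxi.
have [M [e [e0 M0 eD hM]]] := lipschitz_aroundP hL Sx.
have xiM : \forall n \near F, `|xi n| <= M.
  have e2 : 0 < e / 2 by rewrite divr_gt0.
  near=> n.
  have zn : `|x - z n| < e / 2 by near: n; exact: cvgr_dist_lt.
  apply: (subdiff_le_lipschitz e2 M0 (Hxi n)) => y yz.
  have xy : `|x - y| < e.
    rewrite -(subrKA (z n)) (le_lt_trans (ler_normD _ _))// (splitr e).
    by rewrite ltr_leD// distrC.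
  by split; [exact: eD|apply: hM => //; lra].
have : compact [set v : 'rV[R]_d | `|v| <= M].
  apply: bounded_closed_compact.
    by exists M; split; [exact: num_real|move=> r Mr v /= vM; lra].
  by apply: closed_comp (@closed_le R M) => v _; exact: norm_continuous.
move=> /(_ (xi @ F) _ xiM)[v [_ Fv]].
have [G [GF FG xiv]] := cluster_refine FF Fv.
exists G, v; split=> //; split=> [|y Dy].
  by apply: eD; rewrite subrr normr0.
have zG : z @ G --> x by move=> A /zx; exact: FG.
apply: (@ler_cvg_to _ G _ _
  (fun n => h (z n) + dot (xi n) (y - z n)) (fun=> h y)).
- apply: cvgD.
    exact: (cvg_comp _ _ zG (lipschitz_around_continuous hL Sx)).
  by apply: cvg_dot => //; apply: cvgB => //; exact: cvg_cst.
- exact: cvg_cst.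
- by apply: nearW => n; have [_] := Hxi n; apply.
Unshelve. all: by end_near. Qed.

End LocallyLipschitz.

(** * Descent along the iterations *)

Section ConvexModels.
Context {R : realType} {d : nat}.
Implicit Types (D : set 'rV[R]_d) (p q : 'rV[R]_d -> R) (v x a : 'rV[R]_d).

Lemma convex_function_sub_affine D p v c : convex_function D p ->
  convex_function D (fun y => p y - dot v y + c).
Proof.
move=> /convex_functionP cp; apply/convex_functionP => x y s t Dx Dy s0 t0 st1.
have := cp _ _ _ _ Dx Dy s0 t0 st1.
have : s * c + t * c = c by rewrite -mulrDl st1 mul1r.
by rewrite dotDr !dotZr; lra.
Qed.

Lemma subdiff_sub_affine D p v c x a :
  subdiff D (fun y => p y - dot v y + c) x a -> subdiff D p x (a + v).
Proof.
move=> [Dx Ha]; split=> // y /Ha.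
by rewrite dotDl (dotBr v); lra.
Qed.

Lemma convex_function_penalty D p q b : 0 <= b ->
  convex_function D p -> convex_function D q ->
  convex_function D (fun y => p y + b * Num.max (q y) 0).
Proof.
move=> b0 /convex_functionP cp /convex_functionP cq.
apply/convex_functionP => x y s t Dx Dy s0 t0 st1.
have Hp := cp _ _ _ _ Dx Dy s0 t0 st1.
have := max0_convex s0 t0 (cq _ _ _ _ Dx Dy s0 t0 st1).
by move=> /(ler_wpM2l b0); lra.
Qed.

End ConvexModels.

(** The distance need not be attained, so the Cauchy-Schwarz bound is applied to
    almost minimal elements of M. *)
Lemma dist0_le_dot {R : realType} {d : nat} (M : set 'rV[R]_d) (r c : R)
    (e : 'rV[R]_d) : (dist 0 M <= r%:E)%E ->
  (forall m, M m -> dot m e <= c) -> - (r * enorm e) <= c.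
Proof.
move=> Mr Mc; apply: (@le_of_small_slack _ _ _ (enorm e)) => t t0 _.
have : (dist 0 M < (r + t)%:E)%E.
  by apply: le_lt_trans Mr _; rewrite lte_fin ltrDl.
move=> /ereal_inf_lt[_ [m Mm <-]]; rewrite lte_fin sub0r enormN => mrt.
have := Mc _ Mm; have := dot_ge_enorm m e.
have := ler_wpM2r (enorm_ge0 e) (ltW mrt); lra.
Qed.

Section Algorithm.
Context {R : realType} {d : nat}.
Context (Sigma D : set 'rV[R]_d) (g0 h0 g1 h1 : 'rV[R]_d -> R).
Context (rho delta : R) (zeta : nat -> R).
Context (xi0 xi1 z : nat -> 'rV[R]_d) (beta : nat -> R).
Hypothesis algo : iPDCA D Sigma g0 h0 g1 h1 rho delta zeta xi0 xi1 z beta.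

Definition penalized (b : R) y := f0 g0 h0 y + b * Num.max (f1 g1 h1 y) 0.

(** The function minimized at iteration k, without its proximal term. *)
Definition model k y := g0 y - h0 (z k) - dot (xi0 k) (y - z k)
  + beta k * Num.max (lin1 g1 h1 xi1 z k y) 0.

Definition step k := enorm (z k.+1 - z k).

(** As 0.-1 = 0, the step that precedes the first iteration is 0. *)
Definition prev_step k := enorm (z k - z k.-1).

(** A common bound on the residual for both criteria; its square is a sum of
    two terms that the descent inequality absorbs separately. *)
Definition tolerance k :=
  Num.sqrt (zeta k ^+ 2 + rho ^+ 2 / 2 * prev_step k ^+ 2).

Lemma beta_gt0 k : 0 < beta k.
Proof.
elim: k => [|k IH]; first exact: (iPDCA_beta0 algo).
rewrite (iPDCA_beta algo); case: ifP => // _.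
by rewrite addr_gt0// (iPDCA_delta algo).
Qed.

Lemma beta_increment_ge0 k : 0 <= beta k.+1 - beta k.
Proof.
rewrite (iPDCA_beta algo); case: ifP => _; last by rewrite subrr.
by rewrite addrAC subrr add0r ltW// (iPDCA_delta algo).
Qed.

Lemma model_convex k : convex_function D g0 -> convex_function D g1 ->
  convex_function D (model k).
Proof.
move=> cg0 cg1.
have -> : model k = fun y =>
    (g0 y - dot (xi0 k) y + (dot (xi0 k) (z k) - h0 (z k))) +
    beta k * Num.max (g1 y - dot (xi1 k) y + (dot (xi1 k) (z k) - h1 (z k))) 0.
  apply/funext => y; rewrite /model /lin1 !dotBr.
  by congr (_ + _ * Num.max _ _); ring.
apply: convex_function_penalty; first exact/ltW/beta_gt0.
  exact: convex_function_sub_affine.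
exact: convex_function_sub_affine.
Qed.

(** Linearizing the convex h0 and h1 at z k overestimates - h0 and - h1. *)
Lemma penalized_le_model k y : D y -> penalized (beta k) y <= model k y.
Proof.
move=> Dy; have [_ /(_ _ Dy) H0] := iPDCA_xi0 algo k.
have [_ /(_ _ Dy) H1] := iPDCA_xi1 algo k.
rewrite /penalized /model /f0 /f1 /lin1 lerD//; first by lra.
apply: ler_wpM2l; first exact/ltW/beta_gt0.
rewrite ge_max !le_max lexx orbT andbT.
by apply/orP; left; lra.
Qed.

Lemma model_at_iterate k : model k (z k) = penalized (beta k) (z k).
Proof. by rewrite /model /penalized /lin1 /f0 /f1 !subrr !dot0r !subr0. Qed.

Lemma residual_le_tolerance k :
  (residual D Sigma g0 h0 g1 h1 rho xi0 xi1 z beta k <= (tolerance k)%:E)%E.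
Proof.
have rho0 := iPDCA_rho algo.
have [cI|[_ cII]] := iPDCA_step algo k.
- apply: le_trans cI _; rewrite lee_fin.
  rewrite -{1}(ger0_norm (iPDCA_zeta_ge0 algo k)) -sqrtr_sqr ler_wsqrtr//.
  by rewrite lerDl mulr_ge0 ?divr_ge0 ?sqr_ge0.
- apply: le_trans cII _; rewrite lee_fin -/(prev_step k).
  set r := _ * _; have r0 : 0 <= r.
    by rewrite !mulr_ge0 ?sqrtr_ge0 ?enorm_ge0 ?invr_ge0 ?ltW.
  rewrite -(ger0_norm r0) -sqrtr_sqr ler_wsqrtr//.
  rewrite /r !exprMn sqr_sqrtr//; have := sqr_ge0 (zeta k); lra.
Qed.

(** An element u + n of the residual set satisfies
    C(y) >= C(z') + <u - rho (z' - z), y - z'>, with <n, y - z'> <= 0 on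
    Sigma. *)
Lemma approximate_model_minimality k y :
  convex_set D -> convex_function D g0 -> convex_function D g1 ->
  Sigma `<=` D -> Sigma y ->
  model k (z k.+1) <= model k y + rho * dot (z k.+1 - z k) (y - z k.+1)
    + tolerance k * enorm (y - z k.+1).
Proof.
move=> cD cg0 cg1 SD Sy.
suff : - (tolerance k * enorm (y - z k.+1)) <=
    model k y - model k (z k.+1) + rho * dot (z k.+1 - z k) (y - z k.+1) by lra.
apply: (dist0_le_dot (residual_le_tolerance k)) => _ [u Hu [n [_ Hn] <-]].
have := subdiff_sub_sqr cD (model_convex k cg0 cg1) Hu.
move=> [_ /(_ _ (SD _ Sy))]; have := Hn _ Sy.
rewrite (dotDl u n) (dotBl u) dotZl (_ : 2 * (rho / 2) = rho); last by field.
lra.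
Qed.

(** The minimality inequality at y = z k. The coefficient sqrt 2 / 2 of the
    second criterion leaves rho/4 in front of the previous squared step, half
    of the rho/2 gained on the current one. *)
Lemma penalized_decrease k :
  convex_set D -> convex_function D g0 -> convex_function D g1 ->
  Sigma `<=` D ->
  penalized (beta k) (z k.+1) + rho / 2 * step k ^+ 2 <=
  penalized (beta k) (z k) + rho / 4 * prev_step k ^+ 2
    + (2 * rho)^-1 * zeta k ^+ 2.
Proof.
move=> cD cg0 cg1 SD; have rho0 := iPDCA_rho algo.
have := approximate_model_minimality k cD cg0 cg1 SD (iPDCA_z algo k).
rewrite model_at_iterate.
have := penalized_le_model k (SD _ (iPDCA_z algo k.+1)).
rewrite -(opprB (z k.+1) (z k)) dotNr enormN -enorm_sqr -/(step k).
have tol2 : tolerance k ^+ 2 = zeta k ^+ 2 + rho ^+ 2 / 2 * prev_step k ^+ 2.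
  by rewrite sqr_sqrtr// addr_ge0 ?sqr_ge0// mulr_ge0 ?divr_ge0 ?sqr_ge0.
have := sqr_ge0 (rho * step k - tolerance k).
rewrite sqrrB tol2 => AM H1 H2.
have AM' : tolerance k * step k <= rho / 2 * step k ^+ 2 +
    rho / 4 * prev_step k ^+ 2 + (2 * rho)^-1 * zeta k ^+ 2.
  rewrite -(ler_pM2l (mulr_gt0 (ltr0Sn _ 1) rho0)).
  have -> : 2%:R * rho * (rho / 2 * step k ^+ 2 +
    rho / 4 * prev_step k ^+ 2 + (2 * rho)^-1 * zeta k ^+ 2) =
    rho ^+ 2 * step k ^+ 2 + rho ^+ 2 / 2 * prev_step k ^+ 2 + zeta k ^+ 2.
    by field; rewrite gt_eqF.
  by move: AM; rewrite mulr2n; lra.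
lra.
Qed.

Lemma zeta_sqr_bounded : exists M, forall n, \sum_(0 <= k < n) zeta k ^+ 2 <= M.
Proof.
have := iPDCA_zeta_sum algo.
have le_lim n : ((\sum_(0 <= k < n) zeta k ^+ 2)%:E <=
    \sum_(0 <= k <oo) (zeta k ^+ 2)%:E)%E.
  rewrite -sumEFin; apply: nneseries_lim_ge => k _ _.
  by rewrite lee_fin sqr_ge0.
case E : (\sum_(0 <= k <oo) _)%E le_lim => [M||] // le_lim _.
  by exists M => n; have := le_lim n; rewrite lee_fin.
by have := le_lim 0%N; rewrite leeNy_eq.
Qed.

Lemma zeta_cvg0 : zeta @ \oo --> 0.
Proof.
apply: cvg0_sqr; first exact: (iPDCA_zeta_ge0 algo).
have [M HM] := zeta_sqr_bounded.
apply: (@almost_decreasing_gap_cvg0 _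
  (fun n => - \sum_(0 <= k < n) zeta k ^+ 2) _ (fun=> 0)).
- by move=> n; exact: sqr_ge0.
- by apply: nearW => n; rewrite big_nat_recr//=; lra.
- by exists 0 => n; rewrite big1.
- by exists (- M) => n; rewrite lerN2.
Qed.

(** A bounded nondecreasing sequence has increments tending to 0, and a nonzero
    increment is at least delta. *)
Lemma penalty_stationary : bounded_fun beta ->
  \forall k \near \oo,
    increase_penalty g1 h1 xi1 z beta k = false.
Proof.
move=> /bounded_fun_has_ubound[M /= HM].
have incr0 : (fun k => beta k.+1 - beta k) @ \oo --> 0.
  apply: (@almost_decreasing_gap_cvg0 _ (fun k => - beta k) _ (fun=> 0)).
  - exact: beta_increment_ge0.
  - by apply: nearW => k; lra.
  - by exists 0 => n; rewrite big1.
  - exists (- M) => k; rewrite lerN2; apply: HM; by exists k.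
have delta0 := iPDCA_delta algo.
apply: (filterS _ (cvgr0_norm_lt _ incr0 _ delta0)) => k /=.
rewrite (iPDCA_beta algo).
by case: ifP => // _; rewrite addrAC subrr add0r gtr0_norm// ltxx.
Qed.

Lemma penalty_eventually_constant : bounded_fun beta ->
  exists K, forall k, (K <= k)%N ->
    increase_penalty g1 h1 xi1 z beta k = false /\ beta k = beta K.
Proof.
move=> /penalty_stationary[K _ HK]; exists K => k Kk; split; first exact: HK.
rewrite -(subnK Kk); elim: (k - K)%N => // n IH.
by rewrite addSn (iPDCA_beta algo) HK//= leq_addl.
Qed.

(** The Lyapunov function is the penalized objective, with the final penalty,
    plus rho/4 times the previous squared step. *)
Lemma step_cvg0 : convex_set D -> convex_function D g0 ->
  convex_function D g1 -> Sigma `<=` D ->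
  has_lbound (f0 g0 h0 @` Sigma) -> bounded_fun beta ->
  step @ \oo --> 0.
Proof.
move=> cD cg0 cg1 SD [m mf] bb; have rho0 := iPDCA_rho algo.
have [K HK] := penalty_eventually_constant bb.
apply: cvg0_sqr; first by move=> n; exact: enorm_ge0.
have gap0 : (fun n => rho / 4 * step n ^+ 2) @ \oo --> 0.
  apply: (@almost_decreasing_gap_cvg0 _
    (fun n => penalized (beta K) (z n) + rho / 4 * prev_step n ^+ 2)
    _ (fun n => (2 * rho)^-1 * zeta n ^+ 2)).
  - by move=> n; rewrite mulr_ge0 ?sqr_ge0// divr_ge0// ltW.
  - exists K => // n /= Kn; have := penalized_decrease n cD cg0 cg1 SD.
    rewrite (proj2 (HK _ Kn)) {2}/prev_step -/(step n); lra.
  - have [M HM] := zeta_sqr_bounded; exists ((2 * rho)^-1 * M) => n.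
    by rewrite -mulr_sumr ler_wpM2l// invr_ge0 mulr_ge0// ltW.
  - exists m => n.
    have mz : m <= f0 g0 h0 (z n).
      by apply: mf; exists (z n) => //; exact: (iPDCA_z algo).
    have pen : 0 <= beta K * Num.max (f1 g1 h1 (z n)) 0.
      by apply: mulr_ge0; [exact/ltW/beta_gt0|rewrite le_max lexx orbT].
    have prev : 0 <= rho / 4 * prev_step n ^+ 2.
      by rewrite mulr_ge0 ?sqr_ge0// divr_ge0// ltW.
    by rewrite /penalized; lra.
have -> : (fun n => step n ^+ 2) =
    (fun n => 4 / rho * (rho / 4 * step n ^+ 2)).
  by apply/funext => n; field; rewrite gt_eqF.
rewrite -(mulr0 (4 / rho)); apply: cvgM => //; exact: cvg_cst.
Qed.

(** When the penalty is kept, the inverse of the step is at most beta or at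
    most the inverse of tnext; small steps exclude the former. *)
Lemma tnext_le_step : convex_set D -> convex_function D g0 ->
  convex_function D g1 -> Sigma `<=` D ->
  has_lbound (f0 g0 h0 @` Sigma) -> bounded_fun beta ->
  \forall k \near \oo, tnext g1 h1 xi1 z k <= step k.
Proof.
move=> cD cg0 cg1 SD fl bb.
have step0 := step_cvg0 cD cg0 cg1 SD fl bb.
have [K HK] := penalty_eventually_constant bb.
have beta_inv : 0 < (beta K)^-1 by rewrite invr_gt0 beta_gt0.
near=> k.
have Kk : (K <= k)%N by near: k; exact: nbhs_infty_ge.
have small : step k < (beta K)^-1.
  have := ler_norm (step k); move/le_lt_trans; apply.
  by near: k; exact: cvgr0_norm_lt.
have [+ betaE] := HK _ Kk; rewrite /increase_penalty betaE => /negbT.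
rewrite -leNgt -/(step k).
have t0 : 0 <= tnext g1 h1 xi1 z k by rewrite le_max lexx orbT.
have s0 : 0 <= step k by exact: enorm_ge0.
rewrite le_max !inver; case: eqVneq => [->|sn0].
  by rewrite leye_eq /=; case: eqVneq => // ->; rewrite leye_eq.
have sgt0 : 0 < step k by rewrite lt_neqAle eq_sym sn0.
rewrite lee_fin.
have /lt_geF -> : beta K < (step k)^-1.
  by rewrite -[beta K]invrK ltf_pV2 ?posrE//.
rewrite orFb.
case: eqVneq => [->//|tn0]; rewrite lee_fin lef_pV2// posrE.
by rewrite lt_neqAle eq_sym tn0.
Unshelve. all: by end_near. Qed.

Lemma tolerance_cvg0 : step @ \oo --> 0 -> tolerance @ \oo --> 0.
Proof.
move=> step0; have prev0 : prev_step @ \oo --> 0 by rewrite -cvg_shiftS.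
have : (fun k => zeta k ^+ 2 + rho ^+ 2 / 2 * prev_step k ^+ 2) @ \oo --> 0.
  have -> : (0 : R) = 0 * 0 + rho ^+ 2 / 2 * (0 * 0) by rewrite !mulr0 addr0.
  apply: cvgD; first by apply: cvgM; exact: zeta_cvg0.
  by apply: cvgM; [exact: cvg_cst|exact: cvgM].
by move=> /(cvg_comp _ _)/(_ (@sqrt_continuous R 0)); rewrite sqrtr0.
Qed.

(** * The limit problem *)

Section AlongFilter.
Context (G : set_system nat) {GF : ProperFilter G} (x v0 v1 : 'rV[R]_d).
Hypotheses (ooG : \oo `<=` G) (step0 : step @ \oo --> 0) (zx : z @ G --> x).

Lemma next_iterate_cvg : (fun k => z k.+1) @ G --> x.
Proof.
have dz0 : (fun k => z k.+1 - z k) @ G --> (0 : 'rV[R]_d).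
  by apply: cvg0_enorm => A /step0; exact: ooG.
rewrite -[x]addr0 (_ : (fun k => z k.+1) = fun k => z k + (z k.+1 - z k)).
  exact: cvgD.
by apply/funext => k; rewrite addrC subrK.
Qed.

(** By convexity of h1, f1 at the next iterate is at most the linearized
    constraint, hence at most the step. *)
Lemma limit_feasible : lipschitz_around D Sigma g1 ->
  lipschitz_around D Sigma h1 -> Sigma x -> Sigma `<=` D ->
  (\forall k \near \oo, tnext g1 h1 xi1 z k <= step k) ->
  f1 g1 h1 x <= 0.
Proof.
move=> g1L h1L Sx SD /ooG tstep.
have znext := next_iterate_cvg.
apply: (@ler_cvg_to _ G _ _ (fun k => f1 g1 h1 (z k.+1)) step).
- apply: cvgB.
    exact: (cvg_comp _ _ znext (lipschitz_around_continuous g1L Sx)).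
  exact: (cvg_comp _ _ znext (lipschitz_around_continuous h1L Sx)).
- by move=> A /step0; exact: ooG.
- apply: (filterS _ tstep) => k; apply: le_trans.
  have [_ /(_ _ (SD _ (iPDCA_z algo k.+1)))] := iPDCA_xi1 algo k.
  by rewrite /tnext le_max /f1 /lin1 => H; apply/orP; left; lra.
Qed.

(** The limit of the approximate minimality of z k.+1; h0 (z k) cancels from
    both sides, and the nonnegative penalty at z k.+1 is dropped. *)
Lemma limit_model_minimality K y :
  convex_set D -> convex_function D g0 -> convex_function D g1 ->
  Sigma `<=` D -> lipschitz_around D Sigma g0 ->
  lipschitz_around D Sigma h1 -> Sigma x ->
  (forall k, (K <= k)%N -> beta k = beta K) ->
  xi0 @ G --> v0 -> xi1 @ G --> v1 -> Sigma y ->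
  g0 x - dot v0 x <= g0 y - dot v0 y
    + beta K * Num.max (g1 y - dot v1 y + (dot v1 x - h1 x)) 0.
Proof.
move=> cD cg0 cg1 SD g0L h1L Sx betaK xi0v xi1v Sy.
have znext := next_iterate_cvg.
have tol0 : tolerance @ G --> 0.
  by move=> A /(tolerance_cvg0 step0); exact: ooG.
have yz : (fun k => y - z k) @ G --> y - x by apply: cvgB => //; exact: cvg_cst.
have yz' : (fun k => y - z k.+1) @ G --> y - x.
  by apply: cvgB => //; exact: cvg_cst.
have dz : (fun k => z k.+1 - z k) @ G --> x - x by exact: cvgB.
have lhs : (fun k => g0 (z k.+1) - dot (xi0 k) (z k.+1 - z k)) @ G -->
    g0 x - dot v0 (x - x).
  apply: cvgB; last exact: cvg_dot.
  exact: (cvg_comp _ _ znext (lipschitz_around_continuous g0L Sx)).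
have pen : (fun k => Num.max (lin1 g1 h1 xi1 z k y) 0) @ G -->
    Num.max (g1 y - h1 x - dot v1 (y - x)) 0.
  have maxc : {for g1 y - h1 x - dot v1 (y - x),
      continuous (fun a : R => Num.max a 0 : R^o)}.
    apply: (@continuous_max R R (fun a => a) (fun=> 0)) => //.
    exact: cvg_cst.
  have lin1_cvg : (fun k => lin1 g1 h1 xi1 z k y) @ G -->
      g1 y - h1 x - dot v1 (y - x).
    apply: cvgB; last exact: cvg_dot.
    apply: cvgB; first exact: cvg_cst.
    exact: (cvg_comp _ _ zx (lipschitz_around_continuous h1L Sx)).
  exact: (cvg_comp _ _ lin1_cvg maxc).
have rhs : (fun k => g0 y - dot (xi0 k) (y - z k)
    + beta K * Num.max (lin1 g1 h1 xi1 z k y) 0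
    + rho * dot (z k.+1 - z k) (y - z k.+1)
    + tolerance k * enorm (y - z k.+1)) @ G -->
    g0 y - dot v0 (y - x)
    + beta K * Num.max (g1 y - h1 x - dot v1 (y - x)) 0
    + rho * dot (x - x) (y - x) + 0 * enorm (y - x).
  apply: cvgD; last by apply: cvgM => //; exact: cvg_enorm.
  apply: cvgD; last by apply: cvgM; [exact: cvg_cst|exact: cvg_dot].
  apply: cvgD; last by apply: cvgM => //; exact: cvg_cst.
  by apply: cvgB; [exact: cvg_cst|exact: cvg_dot].
have lim_le : g0 x - dot v0 (x - x) <= g0 y - dot v0 (y - x)
    + beta K * Num.max (g1 y - h1 x - dot v1 (y - x)) 0
    + rho * dot (x - x) (y - x) + 0 * enorm (y - x).
  apply: ler_cvg_to lhs rhs _; apply: ooG; exists K => // k /= Kk.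
  have := approximate_model_minimality k cD cg0 cg1 SD Sy.
  rewrite /model betaK//.
  have : 0 <= beta K * Num.max (lin1 g1 h1 xi1 z k (z k.+1)) 0.
    by apply: mulr_ge0; [exact/ltW/beta_gt0|rewrite le_max lexx orbT].
  lra.
move: lim_le; rewrite !subrr dot0l dot0r !dotBr.
have -> : g1 y - h1 x - (dot v1 y - dot v1 x) =
  g1 y - dot v1 y + (dot v1 x - h1 x) by lra.
lra.
Qed.

End AlongFilter.

End Algorithm.

Theorem theorem1 (R : realType) (d : nat)
  (Sigma D : set 'rV[R]_d) (g0 h0 g1 h1 : 'rV[R]_d -> R)
  (rho delta : R) (zeta : nat -> R)
  (xi0 xi1 z : nat -> 'rV[R]_d) (beta : nat -> R)
  (Sigma_closed : closed Sigma) (Sigma_convex : convex_set Sigma)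
  (SigmaD : Sigma `<=` D) (D_convex : convex_set D)
  (g0_convex : convex_function D g0) (h0_convex : convex_function D h0)
  (g1_convex : convex_function D g1) (h1_convex : convex_function D h1)
  (f0_lbound : has_lbound (f0 g0 h0 @` Sigma))
  (algo : iPDCA D Sigma g0 h0 g1 h1 rho delta zeta xi0 xi1 z beta)
  (z_bounded : bounded_fun z) (beta_bounded : bounded_fun beta)
  (g0_lip : lipschitz_around D Sigma g0)
  (g1_lip : lipschitz_around D Sigma g1)
  (h1_lip : lipschitz_around D Sigma h1)
  (h0_lip : lipschitz_around D Sigma h0) :
  forall zbar : 'rV[R]_d,
    cluster (z @ \oo) zbar -> KKT_point D Sigma g0 h0 g1 h1 zbar.
Proof.
move=> x zx.
have step0 := step_cvg0 algo D_convex g0_convex g1_convex SigmaD f0_lbound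
  beta_bounded.
have tstep := tnext_le_step algo D_convex g0_convex g1_convex SigmaD f0_lbound
  beta_bounded.
have [K HK] := penalty_eventually_constant algo beta_bounded.
have [G1 [G1F ooG1 zG1]] := cluster_refine _ zx.
have Sx : Sigma x.
  apply: (closed_cvg _ Sigma_closed _ _ zG1).
  by apply: nearW => k; exact: (iPDCA_z algo).
have [G2 [v0 [G2F G12 xi0v v0x]]] :=
  subgradients_cluster G1F h0_lip Sx zG1 (iPDCA_xi0 algo).
have zG2 : z @ G2 --> x by move=> A /zG1; exact: G12.
have [G [v1 [GF G23 xi1v v1x]]] :=
  subgradients_cluster G2F h1_lip Sx zG2 (iPDCA_xi1 algo).
have zG : z @ G --> x by move=> A /zG2; exact: G23.
have ooG : \oo `<=` G by move=> A /ooG1 /G12; exact: G23.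
have xi0G : xi0 @ G --> v0 by move=> A /xi0v; exact: G23.
have f1x := limit_feasible algo ooG step0 zG g1_lip h1_lip Sx SigmaD tstep.
have Dx : nbhs x D by have [U [nU UD _]] := g0_lip _ Sx; exact: filterS nU.
pose p y := g0 y - dot v0 y + 0.
pose q y := g1 y - dot v1 y + (dot v1 x - h1 x).
have qx : q x = f1 g1 h1 x by rewrite /q /f1; lra.
have px y : Sigma y -> p x <= p y + beta K * Num.max (q y) 0.
  rewrite /p !addr0.
  apply: (limit_model_minimality algo ooG step0 zG D_convex g0_convex g1_convex)
    => //.
  by move=> k /HK[].
have pc : convex_function D p by exact: convex_function_sub_affine.
have qc : convex_function D q by exact: convex_function_sub_affine.
have qx0 : q x <= 0 by rewrite qx; exact: f1x.
have [lambda [a [b [n [lam0 lamq [Ha Hb] Hn abn]]]]] :=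
  exact_penalty_multiplier Sigma_convex D_convex Dx pc qc
    (ltW (beta_gt0 algo K)) Sx qx0 px.
split; first by split=> //; exact: f1x.
exists lambda; split=> //; last by rewrite -qx mulrC.
exists (a + v0), v0, (b + v1), v1, n; split=> //.
  by split=> //; exact: subdiff_sub_affine Ha.
  by split=> //; exact: subdiff_sub_affine Hb.
by rewrite !addrK abn.
Qed.
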